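(* Let $\mathfrak{g}$ be the 4-dimensional real Lie algebra with basis $\{e_1,e_2,e_3,e_4\}$ whose nonzero brackets of basis vectors are determined (up to antisymmetry) by $$[e_1,e_3]=[e_4,e_2]=e_1,\qquad [e_1,e_4]=[e_2,e_3]=e_2,$$ and let $(G,H,g)$, $H=(J_1,J_2,J_3)$, be the corresponding Lie group equipped with the standard left-invariant structure $(J_1,J_2,J_3,g)$ described in the context. Then $(G,H,g)$ belongs to the class $\mathcal{W}^0$ of the (locally) conformally equivalent $\mathcal{K}$-manifolds; that is, it belongs to $\mathcal{W}=\mathcal{W}_4(J_1)\cap\mathcal{W}_1(J_2)\cap\mathcal{W}_1(J_3)$ and $\mathrm{d}(\theta_1\circ J_1)=0$.
   Context: Standard structure: given a 4-dimensional real Lie algebra $\mathfrak{g}$ with a fixed basis $\{e_1,e_2,e_3,e_4\}$, let $G$ be the simply connected Lie group with Lie algebra $\mathfrak{g}$, and regard elements of $\mathfrak{g}$ as left-invariant vector fields on $G$. Define left-invariant endomorphisms $$J_1e_1=e_2,\ J_1e_2=-e_1,\ J_1e_3=-e_4,\ J_1e_4=e_3;$$ $$J_2e_1=e_3,\ J_2e_2=e_4,\ J_2e_3=-e_1,\ J_2e_4=-e_2;$$ $$J_3e_1=-e_4,\ J_3e_2=e_3,\ J_3e_3=-e_2,\ J_3e_4=e_1,$$ and the left-invariant neutral metric $g$ with $g(x,y)=x^1y^1+x^2y^2-x^3y^3-x^4y^4$ for $x=\sum x^ie_i$, $y=\sum y^ie_i$. Then $g(x,y)=\varepsilon_\alpha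 g(J_\alpha x,J_\alpha y)$ with $\varepsilon_1=1$, $\varepsilon_2=\varepsilon_3=-1$. Structure tensors: let $\nabla$ be the Levi-Civita connection of $g$. For $\alpha=1,2,3$ put $F_\alpha(x,y,z)=g((\nabla_xJ_\alpha)y,z)$ and $\theta_\alpha(z)=g^{ij}F_\alpha(e_i,e_j,z)$, where $(g^{ij})$ is the inverse matrix of $(g(e_i,e_j))$ (summation convention). Classes (dimension 4; conditions are for all $x,y,z$): - $\mathcal{K}$: $\nabla J_\alpha=0$ for all $\alpha=1,2,3$. - $\mathcal{W}_4(J_1)$: $F_1(x,y,z)=\frac12\{g(x,y)\theta_1(z)-g(x,z)\theta_1(y)-g(x,J_1y)\theta_1(J_1z)+g(x,J_1z)\theta_1(J_1y)\}$. - $\mathcal{W}_1(J_\alpha)$, $\alpha=2,3$: $F_\alpha(x,y,z)=\frac14\{g(x,y)\theta_\alpha(z)+g(x,z)\theta_\alpha(y)+g(x,J_\alpha y)\theta_\alpha(J_\alpha z)+g(x,J_\alpha z)\theta_\alpha(J_\alpha y)\}$. - $\mathcal{W}=\mathcal{W}_4(J_1)\cap\mathcal{W}_1(J_2)\cap\mathcal{W}_1(J_3)$, and $\mathcal{W}^0=\{\mathcal{W}\mid \mathrm{d}(\theta_1\circ J_1)=0\}$ is the subclass of $\mathcal{W}$ on which the 1-form $\theta_1\circ J_1$ is closed; it is the class of manifolds (locally) conformally equivalent to $\mathcal{K}$-manifolds, where a conformal transformation of the metric is $\bar g=e^{2u}g$ for a differentiable function $u$. *)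

(* Defs.v *)
From HB Require Import structures.
From mathcomp Require Import all_boot all_order all_algebra.
From mathcomp Require Import all_classical all_reals all_analysis.

Set Implicit Arguments.
Unset Strict Implicit.
Unset Printing Implicit Defensive.

Import Order.TTheory GRing.Theory Num.Theory.
Import numFieldNormedType.Exports.

Local Open Scope ring_scope.

(* C^k maps between normed spaces: f is C^(k+1) iff it is differentiable
   everywhere and each of its directional derivatives is C^k. *)
Fixpoint is_Ck {R : realType} {V W : normedModType R} (k : nat) (f : V -> W) :
    Prop :=
  match k with
  | 0 => continuous f
  | k'.+1 => (forall p, differentiable f p)
             /\ forall v : V, is_Ck k' (fun p => 'D_v f p)
  end.

Definition smooth {R : realType} {V W : normedModType R} (f : V -> W) : Prop :=
  forall k, is_Ck k f.

Definition R4 (R : realType) : normedModType R := 'rV[R]_4.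

(* A Lie group whose underlying manifold is R^4 with its standard smooth
   structure.  Such a group is simply connected, hence it is determined up to
   isomorphism by its Lie algebra; conversely, a simply connected Lie group with
   a solvable Lie algebra of dimension 4 is diffeomorphic to R^4.  The Lie algebra
   under study has abelian derived algebra span(e1, e2), so "the simply connected
   Lie group with Lie algebra g" means exactly a Lie group on R^4 with Lie
   algebra g.  Every tangent space is identified with R^4. *)
Record lie_group (R : realType) := LieGroup {
  gmul : R4 R -> R4 R -> R4 R;
  gone : R4 R;
  ginv : R4 R -> R4 R;
  gmulA : forall p q r, gmul p (gmul q r) = gmul (gmul p q) r;
  gmul1 : forall p, gmul gone p = p;
  gmulV : forall p, gmul (ginv p) p = gone;
  gmul_smooth : smooth (fun pq : R4 R * R4 R => gmul pq.1 pq.2);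
  ginv_smooth : smooth ginv }.

Section VectorFields.
Variable R : realType.

(* Statements about vector fields and functions carry an explicit [smooth]
   hypothesis. *)
Definition vfield := R4 R -> R4 R.
Definition scalar_field := R4 R -> R.

Definition act (X : vfield) (f : scalar_field) : scalar_field := fun p => 'D_(X p) f p.

Definition lie_bracket (X Y : vfield) : vfield :=
  fun p => 'D_(X p) Y p - 'D_(Y p) X p.

(* The differential at p of the left translation by q sends X p to X (q p). *)
Definition left_invariant (G : lie_group R) (X : vfield) : Prop :=
  smooth X /\ forall q p, 'D_(X p) (gmul G q) p = X (gmul G q p).

(* e is a basis of the Lie algebra of left-invariant vector fields of G. *)
Definition lie_algebra_basis (G : lie_group R) (e : 'I_4 -> vfield) : Prop :=
  (forall i, left_invariant G (e i)) /\
  forall X, left_invariant G X ->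
    exists! c : 'rV[R]_4, forall p, X p = \sum_i c 0 i *: e i p.

Definition frame (e1 e2 e3 e4 : vfield) : 'I_4 -> vfield :=
  tnth [tuple e1; e2; e3; e4].

Definition frame_mx (e : 'I_4 -> vfield) (p : R4 R) : 'M[R]_4 :=
  \matrix_i e i p.

(* The row (v^1, ..., v^4) such that v = \sum_i v^i e_i at p. *)
Definition coords (e : 'I_4 -> vfield) (p v : R4 R) : 'rV[R]_4 :=
  v *m invmx (frame_mx e p).

(* Tensor fields of type (1,1) and (0,2), given pointwise. *)
Definition endo_field := R4 R -> R4 R -> R4 R.
Definition bilin_field := R4 R -> R4 R -> R4 R -> R.

Definition app (J : endo_field) (X : vfield) : vfield := fun p => J p (X p).
Definition eval2 (g : bilin_field) (X Y : vfield) : scalar_field :=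
  fun p => g p (X p) (Y p).

(* The left-invariant endomorphism with matrix A in the frame e: the i-th ROW of
   A lists the components of the image of e_i. *)
Definition left_inv_endo (e : 'I_4 -> vfield) (A : 'M[R]_4) : endo_field :=
  fun p v => coords e p v *m A *m frame_mx e p.

Definition mx_of_rows (s : seq (seq int)) : 'M[R]_4 :=
  \matrix_(i, j) (nth 0 (nth [::] s i) j)%:~R.

Definition J1 (e : 'I_4 -> vfield) : endo_field :=
  left_inv_endo e (mx_of_rows [:: [::  0;  1;  0;  0];
                                  [:: -1;  0;  0;  0];
                                  [::  0;  0;  0; -1];
                                  [::  0;  0;  1;  0]]).

Definition J2 (e : 'I_4 -> vfield) : endo_field :=
  left_inv_endo e (mx_of_rows [:: [::  0;  0;  1;  0];
                                  [::  0;  0;  0;  1];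
                                  [:: -1;  0;  0;  0];
                                  [::  0; -1;  0;  0]]).

Definition J3 (e : 'I_4 -> vfield) : endo_field :=
  left_inv_endo e (mx_of_rows [:: [::  0;  0;  0; -1];
                                  [::  0;  0;  1;  0];
                                  [::  0; -1;  0;  0];
                                  [::  1;  0;  0;  0]]).

(* x^1 y^1 + x^2 y^2 - x^3 y^3 - x^4 y^4 *)
Definition neutral_metric (e : 'I_4 -> vfield) : bilin_field :=
  fun p v w =>
    \sum_(i < 4) (-1) ^+ (1 < i)%N * (coords e p v 0 i * coords e p w 0 i).

Record is_levi_civita (g : bilin_field) (nabla : vfield -> vfield -> vfield) :
    Prop := IsLeviCivita {
  lc_smooth : forall X Y, smooth X -> smooth Y -> smooth (nabla X Y);
  lc_addl : forall X X' Y, smooth X -> smooth X' -> smooth Y ->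
    nabla (fun p => X p + X' p) Y = fun p => nabla X Y p + nabla X' Y p;
  lc_scalel : forall (f : scalar_field) X Y, smooth f -> smooth X ->
    smooth Y -> nabla (fun p => f p *: X p) Y = fun p => f p *: nabla X Y p;
  lc_addr : forall X Y Y', smooth X -> smooth Y -> smooth Y' ->
    nabla X (fun p => Y p + Y' p) = fun p => nabla X Y p + nabla X Y' p;
  lc_leibniz : forall (f : scalar_field) X Y, smooth f -> smooth X ->
    smooth Y -> nabla X (fun p => f p *: Y p) =
                fun p => act X f p *: Y p + f p *: nabla X Y p;
  lc_torsion_free : forall X Y, smooth X -> smooth Y ->
    (fun p => nabla X Y p - nabla Y X p) = lie_bracket X Y;
  lc_metric : forall X Y Z, smooth X -> smooth Y -> smooth Z ->
    act X (eval2 g Y Z) =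
    fun p => eval2 g (nabla X Y) Z p + eval2 g Y (nabla X Z) p }.

Section StructureTensors.
Variables (g : bilin_field) (nabla : vfield -> vfield -> vfield).
Variable (e : 'I_4 -> vfield).

(* F(X, Y, Z) = g((nabla_X J) Y, Z), with
   (nabla_X J) Y = nabla_X (J Y) - J (nabla_X Y). *)
Definition Ften (J : endo_field) (X Y Z : vfield) : scalar_field :=
  eval2 g (fun p => nabla X (app J Y) p - app J (nabla X Y) p) Z.

Definition gram (p : R4 R) : 'M[R]_4 := \matrix_(i, j) eval2 g (e i) (e j) p.

Definition theta (J : endo_field) (Z : vfield) : scalar_field :=
  fun p => \sum_(i < 4) \sum_(j < 4)
             invmx (gram p) i j * Ften J (e i) (e j) Z p.

Definition class_W4 (J : endo_field) : Prop :=
  forall X Y Z, smooth X -> smooth Y -> smooth Z -> forall p,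
    let th := theta J in
    Ften J X Y Z p =
      2^-1 * (eval2 g X Y p * th Z p - eval2 g X Z p * th Y p
              - eval2 g X (app J Y) p * th (app J Z) p
              + eval2 g X (app J Z) p * th (app J Y) p).

Definition class_W1 (J : endo_field) : Prop :=
  forall X Y Z, smooth X -> smooth Y -> smooth Z -> forall p,
    let th := theta J in
    Ften J X Y Z p =
      4^-1 * (eval2 g X Y p * th Z p + eval2 g X Z p * th Y p
              + eval2 g X (app J Y) p * th (app J Z) p
              + eval2 g X (app J Z) p * th (app J Y) p).

(* A 1-form is seen as a map from vector fields to functions. *)
Definition ext_d (omega : vfield -> scalar_field) (X Y : vfield) : scalar_field :=
  fun p => act X (omega Y) p - act Y (omega X) p - omega (lie_bracket X Y) p.

Definition closed_form (omega : vfield -> scalar_field) : Prop :=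
  forall X Y, smooth X -> smooth Y -> forall p, ext_d omega X Y p = 0.

Definition class_W (Ja Jb Jc : endo_field) : Prop :=
  [/\ class_W4 Ja, class_W1 Jb & class_W1 Jc].

Definition class_W0 (Ja Jb Jc : endo_field) : Prop :=
  class_W Ja Jb Jc /\ closed_form (fun X => theta Ja (app Ja X)).

End StructureTensors.

End VectorFields.

(* Main.v *)
(* A left-invariant frame is pointwise independent, so every smooth vector
   field has smooth coordinates in it, and nabla is determined by the coordinates
   of nabla_{e_i} e_j. The metric has constant coefficients in the frame, so the
   Koszul formula expresses these through the structure constants. In frame
   coordinates nabla_X Y = X(y) + y omega(x), hence F_J(X, Y, Z) =
   g(y [A, omega(x)], z) with A the matrix of J: the derivative terms cancel and
   the class conditions become polynomial identities in x, y, z. The Lee forms are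
   theta_1 = -2 e^4, theta_2 = 4 e^1, theta_3 = 4 e^2, so theta_1 o J_1 = 2 e^3,
   which is closed because e_3 does not occur in the derived algebra. *)

From HB Require Import structures.
Require Import Defs.
From mathcomp Require Import all_boot all_order all_algebra.
From mathcomp Require Import all_classical all_reals all_analysis.
From mathcomp Require Import ring lra.

Set Implicit Arguments.
Unset Strict Implicit.
Unset Printing Implicit Defensive.

Import Order.TTheory GRing.Theory Num.Theory.
Import numFieldNormedType.Exports.

Local Open Scope ring_scope.

(** * Closure properties of C^k and smooth maps *)

Section SmoothMaps.
Variables (R : realType) (V : normedModType R).

Lemma smooth_differentiable (W : normedModType R) (f : V -> W) :
  smooth f -> forall p, differentiable f p.
Proof. by move=> /(_ 1%N)[]. Qed.

Lemma is_CkW (W : normedModType R) k (f : V -> W) : is_Ck k.+1 f -> is_Ck k f.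
Proof.
elim: k f => [|k IHk] f [df Df]; first by move=> p; exact: differentiable_continuous.
by split=> // v; apply: IHk.
Qed.

Lemma is_Ck_cst (W : normedModType R) k (c : W) : is_Ck k (fun _ : V => c).
Proof.
elim: k c => [|k IHk] c; first by move=> p; exact: cvg_cst.
split=> [p|v]; first exact: differentiable_cst.
have -> : (fun p => 'D_v (fun _ : V => c) p) = fun=> 0.
  by apply/funext => p; exact: derive_cst.
exact: IHk.
Qed.

Lemma is_CkD (W : normedModType R) k (f g : V -> W) :
  is_Ck k f -> is_Ck k g -> is_Ck k (fun p => f p + g p).
Proof.
elim: k f g => [|k IHk] f g; first by move=> cf cg p; apply: cvgD; [exact: cf|exact: cg].
move=> [df Df] [dg Dg]; split=> [p|v]; first exact: differentiableD.
have -> : (fun p => 'D_v (fun p => f p + g p) p) = fun p => 'D_v f p + 'D_v g p.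
  by apply/funext => p; apply: deriveD; exact: diff_derivable.
by apply: IHk; [exact: Df|exact: Dg].
Qed.

(** A continuous linear map is its own differential, so the chain rule moves it out of the
    directional derivative. [L] comes as a bare function and is packed into a linear map inside the
    proof. *)
Lemma derive_linear (W W' : normedModType R) (L : W -> W') (f : V -> W) v p :
  linear L -> continuous L -> differentiable f p ->
  differentiable (fun q => L (f q)) p /\
  'D_v (fun q => L (f q)) p = L ('D_v f p).
Proof.
move=> linL cL df.
pose LM := GRing.isLinear.Build _ _ _ _ _ linL.
pose LL : {linear W -> W'} := HB.pack L LM.
have dL q : differentiable LL q by exact: linear_differentiable.
have dLf : differentiable (LL \o f) p by exact: differentiable_comp.
split; first exact: dLf.
rewrite [LHS](@deriveE _ _ _ (LL \o f))// deriveE// diff_comp//.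
by rewrite -[LHS]/('d LL (f p) ('d f p v)) diff_lin.
Qed.

Lemma is_Ck_linear (W W' : normedModType R) (L : W -> W') k (f : V -> W) :
  linear L -> continuous L -> is_Ck k f -> is_Ck k (fun p => L (f p)).
Proof.
move=> linL cL; elim: k f => [|k IHk] f.
  by move=> cf p; apply: continuous_comp; [exact: cf|exact: cL].
move=> [df Df]; split=> [p|v]; first by have [] := derive_linear 0 linL cL (df p).
have -> : (fun p => 'D_v (fun p => L (f p)) p) = fun p => L ('D_v f p).
  by apply/funext => p; have [] := derive_linear v linL cL (df p).
by apply: IHk; exact: Df.
Qed.

Lemma is_CkM k (f g : V -> R) :
  is_Ck k f -> is_Ck k g -> is_Ck k (fun p => f p * g p).
Proof.
elim: k f g => [|k IHk] f g; first by move=> cf cg p; apply: cvgM; [exact: cf|exact: cg].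
move=> fC gC; have [df Df] := fC; have [dg Dg] := gC.
split=> [p|v]; first exact: differentiableM.
have -> : (fun p => 'D_v (fun p => f p * g p) p) =
    fun p => f p * 'D_v g p + g p * 'D_v f p.
  by apply/funext => p; apply: deriveM; exact: diff_derivable.
(* The product rule involves [f] and [g] themselves next to their derivatives, so they are first
   lowered to order [k]. *)
by apply: is_CkD; apply: IHk; first [exact: is_CkW | exact: Df | exact: Dg].
Qed.

(** The derivative of 1/f is -(1/f)^2 times that of f. It contains 1/f again, but only one order
    lower, so the induction on [k] closes. *)
Lemma is_CkV k (f : V -> R) :
  (forall p, f p != 0) -> is_Ck k f -> is_Ck k (fun p => (f p)^-1).
Proof.
move=> f0; elim: k => [|k IHk].
  by move=> cf p; apply: cvgV; [exact: f0|exact: cf].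
move=> fC; have [df Df] := fC.
split=> [p|v]; first exact: differentiableV.
have -> : (fun p => 'D_v (fun p => (f p)^-1) p) =
    fun p => (-1) * ((f p)^-1 * (f p)^-1) * 'D_v f p.
  apply/funext => p; rewrite deriveV //; last exact: diff_derivable.
  by rewrite /GRing.scale/= expr2 invfM mulN1r.
apply: is_CkM; last exact: Df.
apply: is_CkM; first exact: is_Ck_cst.
by apply: is_CkM; apply: IHk; exact: is_CkW.
Qed.

Lemma smooth_cst (W : normedModType R) (c : W) : smooth (fun _ : V => c).
Proof. by move=> k; exact: is_Ck_cst. Qed.

Lemma smoothD (W : normedModType R) (f g : V -> W) :
  smooth f -> smooth g -> smooth (fun p => f p + g p).
Proof. by move=> fC gC k; exact: is_CkD. Qed.

Lemma smoothM (f g : V -> R) :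
  smooth f -> smooth g -> smooth (fun p => f p * g p).
Proof. by move=> fC gC k; exact: is_CkM. Qed.

Lemma smoothV (f : V -> R) :
  (forall p, f p != 0) -> smooth f -> smooth (fun p => (f p)^-1).
Proof. by move=> f0 fC k; exact: is_CkV. Qed.

Lemma smooth_sum (W : normedModType R) I (s : seq I) (f : I -> V -> W) :
  (forall i, smooth (f i)) -> smooth (fun p => \sum_(i <- s) f i p).
Proof.
move=> fC; elim: s => [|i s IHs].
  by under eq_fun do rewrite big_nil; exact: smooth_cst.
by under eq_fun do rewrite big_cons; exact: smoothD.
Qed.

Lemma smooth_prod I (s : seq I) (f : I -> V -> R) :
  (forall i, smooth (f i)) -> smooth (fun p => \prod_(i <- s) f i p).
Proof.
move=> fC; elim: s => [|i s IHs].
  by under eq_fun do rewrite big_nil; exact: smooth_cst.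
by under eq_fun do rewrite big_cons; exact: smoothM.
Qed.

Lemma smooth_det n (M : V -> 'M[R]_n) :
  (forall i j, smooth (fun p => M p i j)) -> smooth (fun p => \det (M p)).
Proof.
move=> MC; apply: smooth_sum => s; apply: smoothM; first exact: smooth_cst.
by apply: smooth_prod => i; exact: MC.
Qed.

Lemma smooth_coord n (f : V -> 'rV[R]_n.+1) i :
  smooth f -> smooth (fun p => f p 0 i).
Proof.
move=> fC k; apply: (is_Ck_linear (L := fun M : 'rV[R]_n.+1 => M 0 i)) => //.
- by move=> a u v; rewrite !mxE.
- exact: coord_continuous.
Qed.

(** Expanding [g] in the standard basis reduces the claim to scalar products, each followed by a
    continuous linear map from R to row vectors. *)
Lemma smoothZ n (f : V -> R) (g : V -> 'rV[R]_n.+1) :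
  smooth f -> smooth g -> smooth (fun p => f p *: g p).
Proof.
move=> fC gC.
under eq_fun => p do rewrite [f p *: g p]row_sum_delta.
apply: smooth_sum => i k; under eq_fun do rewrite mxE.
apply: (is_Ck_linear (L := fun x : R => x *: delta_mx 0 i : 'rV[R]_n.+1)
  (f := fun p => f p * g p 0 i)).
- by move=> a u v; rewrite scalerDl scalerA.
- exact: scalel_continuous.
- by apply: is_CkM => //; exact: smooth_coord.
Qed.

End SmoothMaps.

(** * Pointwise independence of left-invariant frames *)

Section LeftInvariantFrames.
Variables (R : realType) (G : lie_group R).

(** The axioms of [lie_group] are the left unit and left inverse laws; the right-hand versions
    follow by the usual group argument. *)
Lemma gmulVr p : gmul G p (ginv G p) = gone G.
Proof.
rewrite -[LHS](gmul1 G) -(gmulV G (ginv G p)) -gmulA.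
by rewrite (gmulA _ (ginv G p)) gmulV gmul1.
Qed.

Lemma gmul1r p : gmul G p (gone G) = p.
Proof. by rewrite -(gmulV G p) gmulA gmulVr gmul1. Qed.

Lemma gmul_differentiable q p : differentiable (gmul G q) p.
Proof.
have dG : differentiable (fun pq : R4 R * R4 R => gmul G pq.1 pq.2) (q, p).
  by apply: smooth_differentiable; exact: gmul_smooth.
apply: (@differentiable_comp _ _ _ _ (fun r : R4 R => (q, r) : R4 R * R4 R)
  (fun pq : R4 R * R4 R => gmul G pq.1 pq.2)) => //.
Qed.

(* A relation at p is carried by the left translations to every point, hence
   is a relation between the vector fields themselves. *)
Lemma frame_unit (e : 'I_4 -> vfield R) :
  lie_algebra_basis G e -> forall p, frame_mx e p \in unitmx.
Proof.
move=> [einv ebasis] p; rewrite -row_free_unit -kermx_eq0.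
apply/rowV0P => v /sub_kermxP; rewrite mulmx_sum_row => vp0.
(* The zero field has unique coefficients in the basis, namely 0; it remains to see that [v] is also
   a coefficient row for it. *)
have inv0 : left_invariant G (fun=> 0).
  by split=> [|q r]; [exact: smooth_cst | rewrite derive0].
have [c [_ cuniq]] := ebasis _ inv0.
have c0 : c = 0 by apply: cuniq => r; rewrite big1 // => i _; rewrite mxE scale0r.
rewrite -c0; apply/esym/cuniq => r.
(* Left translation by this [q] carries [p] to the arbitrary point [r]. *)
pose q := gmul G r (ginv G p).
have qp : gmul G q p = r by rewrite /q -gmulA gmulV gmul1r.
have -> : \sum_i v 0 i *: e i r = 'd (gmul G q) p (\sum_i v 0 i *: row i (frame_mx e p)).
  rewrite linear_sum; apply: eq_bigr => i _; rewrite linearZ rowK -deriveE.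
    by rewrite (einv i).2 qp.
  exact: gmul_differentiable.
by rewrite vp0 linear0.
Qed.

End LeftInvariantFrames.

(** * Components of vector fields and endomorphisms in a frame *)

Section FrameCalculus.
Variables (R : realType) (e : 'I_4 -> vfield R).
Hypothesis e_smooth : forall i, smooth (e i).
Hypothesis e_unit : forall p, frame_mx e p \in unitmx.

Lemma coords_linear p : linear (coords e p).
Proof. by move=> a u v; rewrite /coords mulmxDl scalemxAl. Qed.

HB.instance Definition _ p :=
  GRing.isLinear.Build R (R4 R) 'rV[R]_4 _ (coords e p) (coords_linear p).

Lemma coordsK p v : coords e p v *m frame_mx e p = v.
Proof. exact: mulmxKV. Qed.

Lemma coords_mul p (c : 'rV[R]_4) : coords e p (c *m frame_mx e p) = c.
Proof. exact: mulmxK. Qed.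

Lemma mul_frame_mx p (c : 'rV[R]_4) : c *m frame_mx e p = \sum_i c 0 i *: e i p.
Proof. by rewrite mulmx_sum_row; apply: eq_bigr => i _; rewrite rowK. Qed.

Lemma coords_frame p i : coords e p (e i p) = delta_mx 0 i.
Proof. by rewrite -[RHS](coords_mul p) -rowE rowK. Qed.

(** By Cramer's rule the inverse frame matrix consists of cofactors divided by the determinant;
    these are polynomial in the frame entries, and the determinant vanishes nowhere. *)
Lemma smooth_coords X i : smooth X -> smooth (fun p => coords e p (X p) 0 i).
Proof.
move=> XC; under eq_fun do rewrite mxE.
apply: smooth_sum => j; apply: smoothM; first exact: smooth_coord.
under eq_fun do rewrite /invmx e_unit !mxE.
have eC k l : smooth (fun p => frame_mx e p k l).
  by under eq_fun do rewrite mxE; exact: smooth_coord.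
apply: smoothM; last first.
  apply: smoothM; first exact: smooth_cst.
  by apply: smooth_det => k l; under eq_fun do rewrite !mxE; exact: smooth_coord.
apply: smoothV; last exact: smooth_det.
by move=> p; have := e_unit p; rewrite unitmxE unitfE.
Qed.

Lemma coords_left_inv_endo A p v :
  coords e p (left_inv_endo e A p v) = coords e p v *m A.
Proof. exact: coords_mul. Qed.

Lemma smooth_left_inv_endo A X : smooth X -> smooth (app (left_inv_endo e A) X).
Proof.
move=> XC; rewrite /app /left_inv_endo.
under eq_fun do rewrite mul_frame_mx.
apply: smooth_sum => i; apply: smoothZ => //.
under eq_fun do rewrite mxE.
apply: smooth_sum => j; apply: smoothM; last exact: smooth_cst.
exact: smooth_coords.
Qed.

(** The term X(y) of the connection formula, which depends on more than the value of [Y] at [p]. *)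
Definition dcoords (X Y : vfield R) (p : R4 R) : 'rV[R]_4 :=
  \row_k act X (fun q => coords e q (Y q) 0 k) p.

(** The matrix of a left-invariant endomorphism is constant in the frame, so differentiation passes
    through it. This makes the derivative terms of F cancel. *)
Lemma dcoords_left_inv_endo A X Y p : smooth Y ->
  dcoords X (app (left_inv_endo e A) Y) p = dcoords X Y p *m A.
Proof.
move=> YC; apply/rowP => k; rewrite !mxE /act.
under eq_fun do rewrite coords_left_inv_endo mxE.
have dY j : differentiable (fun q => coords e q (Y q) 0 j) p.
  by apply: smooth_differentiable; exact: smooth_coords.
have dYA j : differentiable (fun q => coords e q (Y q) 0 j * A j k) p.
  by apply: differentiableM; [exact: dY|exact: differentiable_cst].
rewrite -[X in 'D__ X _]fct_sumE derive_sum; last by move=> j; exact/diff_derivable/dYA.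
apply: eq_bigr => j _; rewrite mxE /act.
have linA : linear (fun x : R => x * A j k).
  by move=> a u v; rewrite mulrDl -scalerAl.
have cA : continuous (fun x : R => x * A j k).
  by move=> x; apply: cvgMl; exact: cvg_id.
by have [_ ->] := derive_linear (X p) linA cA (dY j).
Qed.

(** * The connection in frame components *)

Section LeviCivita.
Variable nabla : vfield R -> vfield R -> vfield R.
Hypothesis nablaP : is_levi_civita (neutral_metric e) nabla.

(** Carries the binary additivity axioms over to the frame expansion of a field; it serves for both
    arguments of [nabla]. *)
Lemma additive_field_sum (T : vfield R -> vfield R) (F : 'I_4 -> vfield R) :
    (forall X X', smooth X -> smooth X' ->
      T (fun p => X p + X' p) = fun p => T X p + T X' p) ->
    T (fun=> 0) = (fun=> 0) -> (forall i, smooth (F i)) ->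
  T (fun p => \sum_i F i p) = fun p => \sum_i T (F i) p.
Proof.
move=> TD T0 FC; elim: (index_enum _) => [|i s IHs].
  by under eq_fun do rewrite big_nil; rewrite T0; apply/funext => p; rewrite big_nil.
under eq_fun do rewrite big_cons.
rewrite TD ?IHs //; last exact: smooth_sum.
by apply/funext => p; rewrite big_cons.
Qed.

Lemma field_expand (X : vfield R) : X = fun p => \sum_i coords e p (X p) 0 i *: e i p.
Proof. by apply/funext => p; rewrite -mul_frame_mx coordsK. Qed.

Lemma nabla0l Y : smooth Y -> nabla (fun=> 0) Y = fun=> 0.
Proof.
move=> YC.
(* The zero field is written as the zero function times itself. *)
have := lc_scalel nablaP (smooth_cst _ (0 : R)) (smooth_cst _ (0 : R4 R)) YC.
under eq_fun do rewrite scale0r.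
by move=> ->; apply/funext => p; rewrite scale0r.
Qed.

Lemma nabla0r X : smooth X -> nabla X (fun=> 0) = fun=> 0.
Proof.
move=> XC.
have := lc_leibniz nablaP (smooth_cst _ (0 : R)) XC (smooth_cst _ (0 : R4 R)).
under eq_fun do rewrite scale0r.
by move=> ->; apply/funext => p; rewrite scale0r scaler0 addr0.
Qed.

(** The matrix of connection 1-forms evaluated at [x]: row j holds the components of the derivative
    of e_j along [x], so it acts on component rows from the right. *)
Definition connection_mx (p : R4 R) (x : 'rV[R]_4) : 'M[R]_4 :=
  \sum_i x 0 i *: \matrix_j coords e p (nabla (e i) (e j) p).

Lemma nabla_frame X j p : smooth X ->
  nabla X (e j) p = \sum_i coords e p (X p) 0 i *: nabla (e i) (e j) p.
Proof.
move=> XC; rewrite {1}(field_expand X).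
rewrite (additive_field_sum (T := nabla^~ (e j))).
- by apply: eq_bigr => i _; rewrite (lc_scalel nablaP) //; exact: smooth_coords.
- by move=> Y Y' YC YC'; rewrite (lc_addl nablaP).
- exact: nabla0l.
- by move=> i; apply: smoothZ => //; exact: smooth_coords.
Qed.

(** With [Y] expanded in the frame, the Leibniz rule separates the derivatives of the coefficients
    from the derivatives of the frame fields. *)
Lemma coords_nabla X Y p : smooth X -> smooth Y ->
  coords e p (nabla X Y p) =
  dcoords X Y p + coords e p (Y p) *m connection_mx p (coords e p (X p)).
Proof.
move=> XC YC; rewrite {1}(field_expand Y).
rewrite (additive_field_sum (T := nabla X)); first last.
- by move=> i; apply: smoothZ => //; exact: smooth_coords.
- exact: nabla0r.
- by move=> Z Z' ZC ZC'; rewrite (lc_addr nablaP).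
transitivity (coords e p (\sum_j (act X (fun q => coords e q (Y q) 0 j) p *: e j p
    + coords e p (Y p) 0 j *: nabla X (e j) p))).
  by congr coords; apply: eq_bigr => j _; rewrite (lc_leibniz nablaP) //; exact: smooth_coords.
rewrite big_split linearD/=; congr (_ + _).
  rewrite -[RHS](coords_mul p) mul_frame_mx; congr coords.
  by apply: eq_bigr => j _; rewrite mxE.
rewrite linear_sum mulmx_sum_row; apply: eq_bigr => j _.
rewrite linearZ /= nabla_frame // linear_sum /=; congr (_ *: _).
rewrite /connection_mx linear_sum; apply: eq_bigr => i _.
by rewrite !linearZ /= rowK.
Qed.

End LeviCivita.

End FrameCalculus.

(** * The neutral metric, the tensors F and theta, and the Koszul formula in a frame *)

Section NeutralMetric.
Variables (R : realType) (e : 'I_4 -> vfield R).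
Hypothesis e_smooth : forall i, smooth (e i).
Hypothesis e_unit : forall p, frame_mx e p \in unitmx.

Definition eps (i : 'I_4) : R := (-1) ^+ (1 < i)%N.

Definition neutral_form (x y : 'rV[R]_4) : R := \sum_i eps i * (x 0 i * y 0 i).

Lemma neutral_formC x y : neutral_form x y = neutral_form y x.
Proof. by apply: eq_bigr => i _; rewrite [x 0 i * _]mulrC. Qed.

Lemma neutral_form_delta x k : neutral_form x (delta_mx 0 k) = eps k * x 0 k.
Proof.
rewrite /neutral_form (bigD1 k) //= big1 => [|i ik].
  by rewrite mxE !eqxx mulr1 addr0.
by rewrite mxE (negPf ik) andbF !mulr0.
Qed.

Lemma eval2_neutral X Y p :
  eval2 (neutral_metric e) X Y p = neutral_form (coords e p (X p)) (coords e p (Y p)).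
Proof. by []. Qed.

Lemma eval2_frame i j : eval2 (neutral_metric e) (e i) (e j) = fun=> eps i *+ (i == j).
Proof.
apply/funext => p; rewrite eval2_neutral !coords_frame // neutral_form_delta mxE eqxx /=.
by rewrite eq_sym; case: eqP => [->|]; rewrite ?mulr1 ?mulr0.
Qed.

(** The Gram matrix is diagonal with entries 1 and -1, hence its own inverse. *)
Lemma invmx_gram p : invmx (gram (neutral_metric e) e p) = diag_mx (\row_i eps i).
Proof.
have gramE : gram (neutral_metric e) e p = diag_mx (\row_i eps i).
  by apply/matrixP => i j; rewrite !mxE eval2_frame.
have gram2 : diag_mx (\row_i eps i) *m gram (neutral_metric e) e p = 1%:M.
  rewrite gramE mulmx_diag; apply/matrixP => i j; rewrite !mxE.
  by rewrite -expr2 sqrr_sign.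
have [_ gram_unit] := mulmx1_unit gram2.
rewrite -[RHS]mulmx1 -(mulmxV gram_unit).
by rewrite mulmxA gram2 mul1mx.
Qed.

Lemma thetaE nabla J Z p : theta (neutral_metric e) nabla e J Z p =
  \sum_i eps i * Ften (neutral_metric e) nabla J (e i) (e i) Z p.
Proof.
rewrite /theta invmx_gram; apply: eq_bigr => i _.
rewrite (bigD1 i) //= big1 => [|j ji]; last first.
  by rewrite !mxE eq_sym (negPf ji) mul0r.
by rewrite !mxE eqxx addr0.
Qed.

Variable nabla : vfield R -> vfield R -> vfield R.
Hypothesis nablaP : is_levi_civita (neutral_metric e) nabla.

Lemma Ften_left_inv_endo A X Y Z p : smooth X -> smooth Y ->
  let x := coords e p (X p) in
  Ften (neutral_metric e) nabla (left_inv_endo e A) X Y Z p =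
  neutral_form (coords e p (Y p) *m
      (A *m connection_mx e nabla p x - connection_mx e nabla p x *m A))
    (coords e p (Z p)).
Proof.
move=> XC YC x; rewrite /Ften eval2_neutral; congr neutral_form.
rewrite linearB /= {2}/app coords_left_inv_endo //.
rewrite !(coords_nabla e_smooth e_unit nablaP) //; last exact: smooth_left_inv_endo.
rewrite dcoords_left_inv_endo // coords_left_inv_endo //.
(* The term [dcoords X Y p *m A] occurs with both signs and cancels, leaving the commutator. *)
by rewrite mulmxDl opprD addrACA subrr add0r mulmxBr !mulmxA.
Qed.

Section Koszul.
Variable C : 'I_4 -> 'I_4 -> 'I_4 -> R.
Hypothesis bracketE :
  forall i j k p, coords e p (lie_bracket (e i) (e j) p) 0 k = C i j k.

(** The metric is constant on frame fields, so the derivative terms of the Koszul formula vanish and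
    metricity says that g(nabla_i e_j, e_k) is skew in j and k. *)
Lemma koszul i j k p :
  2 * (eps k * coords e p (nabla (e i) (e j) p) 0 k) =
  eps k * C i j k - eps i * C j k i + eps j * C k i j.
Proof.
pose Gam i j k : R := coords e p (nabla (e i) (e j) p) 0 k.
have torsion i' j' k' : Gam i' j' k' - Gam j' i' k' = C i' j' k'.
  rewrite -(bracketE i' j' k' p) -(lc_torsion_free nablaP) //.
  by rewrite linearB [RHS]mxE; congr (_ + _); rewrite [RHS]mxE.
have metric i' j' k' : eps k' * Gam i' j' k' + eps j' * Gam i' k' j' = 0.
  have /(congr1 (@^~ p)) := lc_metric nablaP (e_smooth i') (e_smooth j') (e_smooth k').
  rewrite eval2_frame /act derive_cst !eval2_neutral !coords_frame //.
  by rewrite [X in _ + X]neutral_formC !neutral_form_delta => <-.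
rewrite -[coords _ _ _ _ _]/(Gam i j k) -!torsion.
(* The goal is now linear in the products of [eps] and [Gam]; the three cyclic metric relations
   settle it. *)
have := metric i j k; have := metric j k i; have := metric k i j.
by move=> *; lra.
Qed.

End Koszul.
End NeutralMetric.

(** * Tables of structure constants and Christoffel symbols *)

Local Notation o0 := (@Ordinal 4 0 isT).
Local Notation o1 := (@Ordinal 4 1 isT).
Local Notation o2 := (@Ordinal 4 2 isT).
Local Notation o3 := (@Ordinal 4 3 isT).

(** Case analysis ending in literal ordinals, on which table lookups compute. *)
Lemma ord4_ind (P : 'I_4 -> Prop) : P o0 -> P o1 -> P o2 -> P o3 -> forall i, P i.
Proof.
move=> P0 P1 P2 P3 [[|[|[|[|//]]]] lti];
  by rewrite (bool_irrelevance lti isT).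
Qed.

Lemma sum4E (V : nmodType) (F : 'I_4 -> V) :
  \sum_i F i = F o0 + F o1 + F o2 + F o3.
Proof.
rewrite !big_ord_recr big_ord0 /= add0r.
by do !congr (_ + _); congr F; apply/val_inj.
Qed.

(* Indices start at 0; omitted trailing entries and rows are zero. *)
Definition table (s : seq (seq (seq int))) (i j k : nat) : int :=
  nth 0 (nth [::] (nth [::] s i) j) k.

Definition structure_constants : nat -> nat -> nat -> int :=
  table [:: [:: [::]; [::]; [:: 1]; [:: 0; 1]];
            [:: [::]; [::]; [:: 0; 1]; [:: -1]];
            [:: [:: -1]; [:: 0; -1]];
            [:: [:: 0; -1]; [:: 1]]].

(** Entry i j k is the e_k component of nabla_{e_i} e_j, as obtained by solving the Koszul formula
    for the structure constants above. *)
Definition christoffel : nat -> nat -> nat -> int :=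
  table [:: [:: [:: 0; 0; 1]; [::]; [:: 1]];
            [:: [::]; [:: 0; 0; 1]; [:: 0; 1]];
            [::];
            [:: [:: 0; -1]; [:: 1]]].

Lemma lie_bracketC (R : realType) (X Y : vfield R) p :
  lie_bracket X Y p = - lie_bracket Y X p.
Proof. by rewrite /lie_bracket opprB. Qed.

(** * The Levi-Civita connection of the given Lie algebra *)

Section Connection.
Variables (R : realType) (e : 'I_4 -> vfield R).
Hypothesis e_smooth : forall i, smooth (e i).
Hypothesis e_unit : forall p, frame_mx e p \in unitmx.
Hypothesis h02 : lie_bracket (e o0) (e o2) = e o0.
Hypothesis h31 : lie_bracket (e o3) (e o1) = e o0.
Hypothesis h03 : lie_bracket (e o0) (e o3) = e o1.
Hypothesis h12 : lie_bracket (e o1) (e o2) = e o1.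
Hypothesis h01 : lie_bracket (e o0) (e o1) = fun=> 0.
Hypothesis h23 : lie_bracket (e o2) (e o3) = fun=> 0.
Variable nabla : vfield R -> vfield R -> vfield R.
Hypothesis nablaP : is_levi_civita (neutral_metric e) nabla.

Lemma coords_bracket i j k p :
  coords e p (lie_bracket (e i) (e j) p) 0 k = (structure_constants i j k)%:~R.
Proof.
have bxx l : lie_bracket (e l) (e l) p = 0 by rewrite /lie_bracket subrr.
(* The hypotheses give each pair in one order only; antisymmetry supplies the six reversed
   brackets. *)
have b20 := lie_bracketC (e o2) (e o0) p; have b13 := lie_bracketC (e o1) (e o3) p.
have b30 := lie_bracketC (e o3) (e o0) p; have b21 := lie_bracketC (e o2) (e o1) p.
have b10 := lie_bracketC (e o1) (e o0) p; have b32 := lie_bracketC (e o3) (e o2) p.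
rewrite ?(h02, h31, h03, h12, h01, h23) in b20 b13 b30 b21 b10 b32.
elim/ord4_ind: i; elim/ord4_ind: j;
  rewrite ?bxx ?(h02, h31, h03, h12, h01, h23, b20, b13, b30, b21, b10, b32);
  rewrite ?linearN ?linear0 ?oppr0 /= ?coords_frame // !mxE ?eqxx /=.
all: by elim/ord4_ind: k; rewrite //= ?mulrN1z ?oppr0.
Qed.

Lemma christoffelP i j k p :
  coords e p (nabla (e i) (e j) p) 0 k = (christoffel i j k)%:~R.
Proof.
have := koszul e_smooth e_unit nablaP coords_bracket i j k p.
elim/ord4_ind: i; elim/ord4_ind: j; elim/ord4_ind: k;
  rewrite /eps /structure_constants /christoffel /table /= ?expr0 ?expr1; lra.
Qed.

(** The connection matrix no longer depends on the point, since the Christoffel symbols are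
    constant. *)
Definition omega (x : 'rV[R]_4) : 'M[R]_4 :=
  \matrix_(j, k) \sum_i x 0 i * (christoffel i j k)%:~R.

Lemma connection_mxE p x : connection_mx e nabla p x = omega x.
Proof.
apply/matrixP => j k; rewrite summxE mxE; apply: eq_bigr => i _.
by rewrite mxE [X in _ * X]mxE christoffelP.
Qed.

End Connection.

(** * Polynomial identities for F and the Lee forms on component rows *)

Section StructureForms.
Variable R : realType.
Implicit Types x y z : 'rV[R]_4.

(** These three matrices are those inside [J1], [J2], [J3], so [J1 e] unfolds to [left_inv_endo e]
    of the first; here they are handled without a frame. *)
Definition A1 : 'M[R]_4 := mx_of_rows R [:: [::  0;  1;  0;  0];
                                            [:: -1;  0;  0;  0];
                                            [::  0;  0;  0; -1];
                                            [::  0;  0;  1;  0]].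

Definition A2 : 'M[R]_4 := mx_of_rows R [:: [::  0;  0;  1;  0];
                                            [::  0;  0;  0;  1];
                                            [:: -1;  0;  0;  0];
                                            [::  0; -1;  0;  0]].

Definition A3 : 'M[R]_4 := mx_of_rows R [:: [::  0;  0;  0; -1];
                                            [::  0;  0;  1;  0];
                                            [::  0; -1;  0;  0];
                                            [::  1;  0;  0;  0]].

(** Through the defaults of [nth], omitted trailing entries and rows are zero. *)
Definition mx4 (s : seq (seq R)) : 'M[R]_4 :=
  \matrix_(i, j) nth 0 (nth [::] s i) j.

Lemma omegaE x : omega x =
  mx4 [:: [:: 0; - x 0 o3; x 0 o0];
          [:: x 0 o3; 0; x 0 o1];
          [:: x 0 o0; x 0 o1]].
Proof.
apply/matrixP; elim/ord4_ind; elim/ord4_ind;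
  rewrite !mxE sum4E /christoffel /table /=; ring.
Qed.

Lemma neutral_formE x y : neutral_form x y =
  x 0 o0 * y 0 o0 + x 0 o1 * y 0 o1 - x 0 o2 * y 0 o2 - x 0 o3 * y 0 o3.
Proof.
by rewrite /neutral_form sum4E /eps /= !expr0 !expr1 !mul1r !mulN1r.
Qed.

Definition structure_form (A : 'M[R]_4) x y z : R :=
  neutral_form (y *m (A *m omega x - omega x *m A)) z.

Definition lee_form (A : 'M[R]_4) z : R :=
  \sum_i eps R i * structure_form A (delta_mx 0 i) (delta_mx 0 i) z.

(** The x^4 part of [omega x] is an infinitesimal rotation of span(e1, e2), which commutes with
    [A1]; only x^1 and x^2 survive. *)
Lemma commutator1 x : A1 *m omega x - omega x *m A1 =
  mx4 [:: [:: 0; 0; x 0 o1; x 0 o0];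
          [:: 0; 0; - x 0 o0; x 0 o1];
          [:: x 0 o1; - x 0 o0];
          [:: x 0 o0; x 0 o1]].
Proof.
rewrite omegaE; apply/matrixP; elim/ord4_ind; elim/ord4_ind;
  rewrite !mxE !sum4E !mxE /=; ring.
Qed.

Lemma commutator2 x : A2 *m omega x - omega x *m A2 =
  mx4 [:: [:: 2 * x 0 o0; x 0 o1; 0; x 0 o3];
          [:: x 0 o1; 0; - x 0 o3];
          [:: 0; x 0 o3; - (2 * x 0 o0); - x 0 o1];
          [:: - x 0 o3; 0; - x 0 o1]].
Proof.
rewrite omegaE; apply/matrixP; elim/ord4_ind; elim/ord4_ind;
  rewrite !mxE !sum4E !mxE /=; ring.
Qed.

Lemma commutator3 x : A3 *m omega x - omega x *m A3 =
  mx4 [:: [:: 0; x 0 o0; x 0 o3];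
          [:: x 0 o0; 2 * x 0 o1; 0; x 0 o3];
          [:: - x 0 o3; 0; - (2 * x 0 o1); x 0 o0];
          [:: 0; - x 0 o3; x 0 o0]].
Proof.
rewrite omegaE; apply/matrixP; elim/ord4_ind; elim/ord4_ind;
  rewrite !mxE !sum4E !mxE /=; ring.
Qed.

Lemma mul_mx4 y s k : (y *m mx4 s) 0 k =
  y 0 o0 * (mx4 s) o0 k + y 0 o1 * (mx4 s) o1 k
  + y 0 o2 * (mx4 s) o2 k + y 0 o3 * (mx4 s) o3 k.
Proof. by rewrite mxE sum4E. Qed.

Lemma lee_form1 z : lee_form A1 z = - (2 * z 0 o3).
Proof.
rewrite /lee_form sum4E /structure_form !commutator1 -!rowE !neutral_formE !mxE.
by rewrite /eps /=; ring.
Qed.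

Lemma lee_form2 z : lee_form A2 z = 4 * z 0 o0.
Proof.
rewrite /lee_form sum4E /structure_form !commutator2 -!rowE !neutral_formE !mxE.
by rewrite /eps /=; ring.
Qed.

Lemma lee_form3 z : lee_form A3 z = 4 * z 0 o1.
Proof.
rewrite /lee_form sum4E /structure_form !commutator3 -!rowE !neutral_formE !mxE.
by rewrite /eps /=; ring.
Qed.

(** With the commutator and the Lee form explicit, both sides are trilinear polynomials in the
    components; [field] deals with the constant inverse. *)
Lemma structure_form1 x y z : structure_form A1 x y z =
  2^-1 * (neutral_form x y * lee_form A1 z - neutral_form x z * lee_form A1 y
          - neutral_form x (y *m A1) * lee_form A1 (z *m A1)
          + neutral_form x (z *m A1) * lee_form A1 (y *m A1)).
Proof.
rewrite /structure_form commutator1 !lee_form1 !neutral_formE !mul_mx4 !mxE !sum4E !mxE /=.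
by field.
Qed.

Lemma structure_form2 x y z : structure_form A2 x y z =
  4^-1 * (neutral_form x y * lee_form A2 z + neutral_form x z * lee_form A2 y
          + neutral_form x (y *m A2) * lee_form A2 (z *m A2)
          + neutral_form x (z *m A2) * lee_form A2 (y *m A2)).
Proof.
rewrite /structure_form commutator2 !lee_form2 !neutral_formE !mul_mx4 !mxE !sum4E !mxE /=.
by field.
Qed.

Lemma structure_form3 x y z : structure_form A3 x y z =
  4^-1 * (neutral_form x y * lee_form A3 z + neutral_form x z * lee_form A3 y
          + neutral_form x (y *m A3) * lee_form A3 (z *m A3)
          + neutral_form x (z *m A3) * lee_form A3 (y *m A3)).
Proof.
rewrite /structure_form commutator3 !lee_form3 !neutral_formE !mul_mx4 !mxE !sum4E !mxE /=.
by field.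
Qed.

End StructureForms.

(** * Class conditions and closedness of theta_1 o J_1 *)

(** Isolates what is used of the group: a smooth, pointwise independent frame with the prescribed
    brackets. *)
Lemma frame_brackets_W0 (R : realType) (e : 'I_4 -> vfield R)
    (nabla : vfield R -> vfield R -> vfield R) :
  (forall i, smooth (e i)) -> (forall p, frame_mx e p \in unitmx) ->
  lie_bracket (e o0) (e o2) = e o0 -> lie_bracket (e o3) (e o1) = e o0 ->
  lie_bracket (e o0) (e o3) = e o1 -> lie_bracket (e o1) (e o2) = e o1 ->
  lie_bracket (e o0) (e o1) = (fun=> 0) -> lie_bracket (e o2) (e o3) = (fun=> 0) ->
  is_levi_civita (neutral_metric e) nabla ->
  class_W0 (neutral_metric e) nabla e (J1 e) (J2 e) (J3 e).
Proof.
move=> eC eU h02 h31 h03 h12 h01 h23 nablaP.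
have connE := connection_mxE eC eU h02 h31 h03 h12 h01 h23 nablaP.
have FE A X Y Z p : smooth X -> smooth Y ->
    Ften (neutral_metric e) nabla (left_inv_endo e A) X Y Z p =
    structure_form A (coords e p (X p)) (coords e p (Y p)) (coords e p (Z p)).
  by move=> XC YC; rewrite Ften_left_inv_endo // !connE.
have thE A Z p : theta (neutral_metric e) nabla e (left_inv_endo e A) Z p =
    lee_form A (coords e p (Z p)).
  rewrite thetaE //; apply: eq_bigr => i _.
  by rewrite FE // !coords_frame.
have appE A Z p : coords e p (app (left_inv_endo e A) Z p) = coords e p (Z p) *m A.
  exact: coords_left_inv_endo.
split.
  split=> X Y Z XC YC ZC p /=; rewrite FE // !thE !eval2_neutral !appE.
  - exact: structure_form1.
  - exact: structure_form2.
  - exact: structure_form3.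
pose xi X p := theta (neutral_metric e) nabla e (J1 e) (app (J1 e) X) p.
(* The e^4 component of J_1 z is -z^3, which turns -2 e^4 into 2 e^3. *)
have xiE X : xi X = fun p => 2 * coords e p (X p) 0 o2.
  apply/funext => p; rewrite /xi [LHS]thE appE lee_form1 mxE sum4E !mxE /=; ring.
have actE X Y p : smooth Y ->
    act X (xi Y) p = 2 * dcoords e X Y p 0 o2.
  move=> YC; rewrite xiE mxE; apply: (@deriveZ _ _ _ (fun q => coords e q (Y q) 0 o2)).
  by apply/diff_derivable/smooth_differentiable; exact: smooth_coords.
move=> X Y XC YC p.
rewrite -[LHS]/(act X (xi Y) p - act Y (xi X) p - xi (lie_bracket X Y) p).
(* Writing the bracket as nabla_X Y - nabla_Y X cancels the derivatives of the components. What
   remains is the e_3 component of y omega(x) - x omega(y), which is zero because x^1 y^1 + x^2 y^2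
   is symmetric. *)
rewrite !actE // xiE -(lc_torsion_free nablaP) //.
rewrite linearB /= !(coords_nabla eC eU nablaP) // !connE !omegaE.
have rowD (u v : 'rV[R]_4) : (u + v) 0 o2 = u 0 o2 + v 0 o2 by rewrite mxE.
have rowN (u : 'rV[R]_4) : (- u) 0 o2 = - u 0 o2 by rewrite mxE.
by rewrite !(rowD, rowN) !mul_mx4 ![mx4 _ _ _]mxE /=; ring.
Qed.

Theorem proposition2p3 (R : realType) (G : lie_group R)
    (e1 e2 e3 e4 : vfield R)
    (he : lie_algebra_basis G (frame e1 e2 e3 e4))
    (h13 : lie_bracket e1 e3 = e1) (h42 : lie_bracket e4 e2 = e1)
    (h14 : lie_bracket e1 e4 = e2) (h23 : lie_bracket e2 e3 = e2)
    (h12 : lie_bracket e1 e2 = fun=> 0) (h34 : lie_bracket e3 e4 = fun=> 0)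
    (nabla : vfield R -> vfield R -> vfield R)
    (hnabla : is_levi_civita (neutral_metric (frame e1 e2 e3 e4)) nabla) :
  let e := frame e1 e2 e3 e4 in
  class_W0 (neutral_metric e) nabla e (J1 e) (J2 e) (J3 e).
Proof.
(* The entries 0 to 3 of [frame] compute to [e1], ..., [e4], so the bracket hypotheses match by
   conversion. *)
move=> e; apply: (frame_brackets_W0 _ _ h13 h42 h14 h23 h12 h34 hnabla).
  by move=> i; have [] := he.1 i.
exact: frame_unit he.
Qed.
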